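(* Suppose the measurable function class $\mathcal F$ has a bounded envelope function. Assume further that there exists a deterministic probability measure $\nu$ on $\mathbb R^p$ such that $$\lim_{C\to\infty}\limsup_{n\to\infty}\mathrm P_{\mathcal O}\big(\mathrm Q_n\nleq C\nu\big)=0$$ and $$\lim_{\delta\downarrow0}\limsup_{m\to\infty}\mathrm E_\nu\big[\|\mathbb G_m^\nu\|_{\mathcal F_\delta}\big]=0,\qquad \mathcal F_\delta:=\{f-g:\ f,g\in\mathcal F,\ \rho_{\mathrm P}(f,g)<\delta\}.$$ Then for every $\epsilon,\eta>0$, $$\lim_{\delta\downarrow0}\limsup_{n\to\infty}\mathrm P_{\mathcal O}\Big\{\mathrm P_{\tilde U}\Big(\sup_{f,g\in\mathcal F:\ \rho_{\mathrm P}(f,g)<\delta}\big|\tilde{\mathbb G}_n[f]-\tilde{\mathbb G}_n[g]\big|>\epsilon\ \Big|\ \mathcal O\Big)>\eta\Big\}=0.$$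
   Context: Setting. $\mathrm P$ is a Borel probability measure on $\mathbb R^p$ and $Z_1,\dots,Z_n$ are i.i.d. from $\mathrm P$. $\mathrm P_U$ is a known base probability distribution. For each $n$, $\hat G_n$ is a (random) fitted generator mapping the base space into $\mathbb R^p$; $\mathcal O$ (depending on $n$) denotes all information (the induced $\sigma$-field) used to construct $\hat G_n$, including the data and any auxiliary training randomness, and $\mathrm P_{\mathcal O}$ is the induced probability on it. $\mathrm Q_n:=\hat G_n\#\mathrm P_U$ (pushforward) is a random probability measure on $\mathbb R^p$. Conditionally on $\mathcal O$, $\tilde Z_i=\hat G_n(\tilde U_i)$ with $\tilde U_1,\dots,\tilde U_n$ i.i.d. from $\mathrm P_U$, so $\tilde Z_1,\dots,\tilde Z_n$ are i.i.d. from $\mathrm Q_n$; $\mathrm P_{\tilde U}(\cdot\mid\mathcal O)$ is conditional probability with respect to this bootstrap randomness. $\tilde{\mathbb G}_n[f]:=\sqrt n\,(n^{-1}\sum_{i=1}^n f(\tilde Z_i)-\mathrm Q_n[f])$. Notation. $\mu f=\mu[f]=\int f\,d\mu$. A bounded envelope is a function $F$, bounded by a finite constant, with $|f|\le F$ for all $f\in\mathcal F$. $\rho_{\mathrm P}(f,g)^2:=\mathrm P[\{(f-g)-\mathrm P[f-g]\}^2]$. For probability measures, $\mu\le D\nu$ means $\mu(A)\le D\nu(A)$ for every Borel set $A$; $\mathrm Q_n\nleq C\nu$ is the event that this fails. For a probability measure $\mu$ and $X_1,\dots,X_m$ i.i.d. from $\mu$, $\mathbb G_m^\mu[a]:=m^{-1/2}\sum_{i=1}^m\{a(X_i)-\mu[a]\}$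 and $\|\mathbb G_m^\mu\|_{\mathcal A}:=\sup_{a\in\mathcal A}|\mathbb G_m^\mu[a]|$; $\mathrm E_\mu$ is expectation over this sample. Standard measurability conditions are imposed so that all suprema and conditional probabilities are measurable. *)

(* Defs.v *)
From HB Require Import structures.
From mathcomp Require Export all_boot all_order all_algebra.
From mathcomp Require Export all_classical all_reals all_analysis.
(* all_analysis does not export the Borel structure on \bar R. *)
From mathcomp Require Export measurable_realfun.

Set Implicit Arguments.
Unset Strict Implicit.
Unset Printing Implicit Defensive.

Import Order.TTheory GRing.Theory Num.Theory.
Import numFieldNormedType.Exports.

Local Open Scope classical_set_scope.
Local Open Scope ring_scope.

(* R^p is p.-tuple R with the sigma-algebra generated by the coordinates, which
   is the Borel sigma-algebra of R^p. *)

Section iid_sample.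
Context {d : measure_display} {T : measurableType d} {R : realType}.

Definition cons_tuple (n : nat) (x : T * n.-tuple T) : n.+1.-tuple T :=
  [tuple of x.1 :: x.2].

Lemma measurable_cons_tuple (n : nat) :
  measurable_fun [set: T * n.-tuple T] (@cons_tuple n).
Proof. exact: measurable_cons. Qed.

HB.instance Definition _ (n : nat) :=
  isMeasurableFun.Build _ _ _ _ (@cons_tuple n) (@measurable_cons_tuple n).

Definition product_probability (d1 d2 : measure_display)
    (T1 : measurableType d1) (T2 : measurableType d2)
    (m1 : probability T1 R) (m2 : probability T2 R) :
    probability (T1 * T2)%type R :=
  (m1 \x m2)%E.

(* The n-fold product mu^n, i.e. the joint law of n i.i.d. draws from mu. *)
Fixpoint iid_law (mu : probability T R) (n : nat) : probability (n.-tuple T) R :=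
  match n with
  | 0%N => \d_([tuple] : 0.-tuple T)
  | k.+1 =>
    distribution (product_probability mu (iid_law mu k)) (@cons_tuple k)
  end.

End iid_sample.

Section empirical_process.
Context {d : measure_display} {T : measurableType d} {R : realType}.
Implicit Types (mu nu P : probability T R) (F : set (T -> R)) (f g a : T -> R).

Definition mean mu f : R := \int[mu]_x f x.

Definition rho P f g : R :=
  Num.sqrt (mean P (fun x => ((f x - g x) - mean P (fun y => f y - g y)) ^+ 2)).

Definition close_pairs P F (delta : R) : set ((T -> R) * (T -> R)) :=
  [set fg | [/\ F fg.1, F fg.2 & rho P fg.1 fg.2 < delta]].

Definition diff_class P F (delta : R) : set (T -> R) :=
  [set (fun x => fg.1 x - fg.2 x) | fg in close_pairs P F delta].

(* 0 is adjoined so that the supremum over an empty index set is 0, and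
   not -oo. *)
Definition sup_abs (S : Type) (A : set S) (h : S -> R) : \bar R :=
  ereal_sup (0%E |` [set `|h s|%:E | s in A]).

Definition emp_process mu (m : nat) (x : m.-tuple T) a : R :=
  (Num.sqrt m%:R)^-1 * \sum_(i < m) (a (tnth x i) - mean mu a).

Definition boot_process mu (n : nat) (z : n.-tuple T) f : R :=
  Num.sqrt n%:R * (n%:R^-1 * \sum_(i < n) f (tnth z i) - mean mu f).

Definition bounded_envelope F : Prop :=
  exists E : T -> R,
    (exists M : R, forall x, E x <= M) /\
    (forall f, F f -> forall x, `|f x| <= E x).

Definition dominated_by mu (D : R) nu : Prop :=
  forall A : set T, measurable A -> (mu A <= D%:E * nu A)%E.

End empirical_process.

Section bootstrap.
Context {dU d : measure_display} {TU : measurableType dU}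
  {T : measurableType d} {R : realType}.
Variables (PU : probability TU R) (G : {mfun TU >-> T}).

Definition generated : probability T R := distribution PU G.

Definition boot_sample (n : nat) (u : n.-tuple TU) : n.-tuple T :=
  [tuple of map G u].

Definition boot_modulus (P : probability T R) (F : set (T -> R)) (n : nat)
    (delta : R) (u : n.-tuple TU) : \bar R :=
  sup_abs (close_pairs P F delta)
    (fun fg => boot_process generated (boot_sample u) fg.1
             - boot_process generated (boot_sample u) fg.2).

(* Given the information O the generator G is fixed and the U~_i are i.i.d.
   from PU, so the conditional probability given O is PU^n with G frozen. *)
Definition boot_prob (P : probability T R) (F : set (T -> R)) (n : nat)
    (delta eps : R) : \bar R :=
  iid_law PU n [set u | (eps%:E < boot_modulus P F delta u)%E].

End bootstrap.

(* Main.v *)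
(* If Q <= C nu, put c = 1/C and K(y, .) = c delta_y + (nu - c Q).  This is a
   Markov kernel with Q K = nu and K(y, f - nu f) = c (f y - Q f), so replacing
   each point of a Q-sample by a draw from K turns it into a nu-sample whose
   centred sums have conditional mean c times the Q-centred sums.  By Jensen,
   E ||G_n^Q|| <= C E ||G_n^nu|| over any class and for the same n.  On the event
   Q_n <= C nu, Markov's inequality then bounds the conditional probability of a
   large bootstrap modulus by C/eps times the deterministic nu-modulus; choose C
   first, then delta. *)
From HB Require Import structures.
Require Import Defs.
From mathcomp Require Import ring.
Set Implicit Arguments.
Unset Strict Implicit.
Unset Printing Implicit Defensive.
Import Order.TTheory GRing.Theory Num.Theory.
Import numFieldNormedType.Exports.
Local Open Scope classical_set_scope.
Local Open Scope ring_scope.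

(** * Difference of two finite measures *)

Section measure_difference.
Local Open Scope ereal_scope.
Context {d : measure_display} {T : measurableType d} {R : realType}.
Variables (mu nu : {finite_measure set T -> \bar R}).
Hypothesis mu_le_nu : forall A, measurable A -> mu A <= nu A.

(* The truncation at 0 only matters on non-measurable sets, where the measure
   functions are unconstrained. *)
Definition measure_sub of (forall A, measurable A -> mu A <= nu A) : set T -> \bar R :=
  fun A => maxe 0 (nu A - mu A).

Local Notation sub := (measure_sub mu_le_nu).

Lemma measure_subE A : measurable A -> sub A = nu A - mu A.
Proof.
move=> mA; rewrite /measure_sub; apply/max_idPr.
by rewrite leeBrDr ?add0e ?mu_le_nu// fin_num_measure.
Qed.

Let sub0 : sub set0 = 0.
Proof. by rewrite measure_subE// !measure0 sube0. Qed.

Let sub_ge0 A : 0 <= sub A.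
Proof. by rewrite /measure_sub le_max lexx. Qed.

Let sub_sigma_additive : semi_sigma_additive sub.
Proof.
move=> F mF tF mUF; rewrite measure_subE//.
have -> : (fun n => \sum_(0 <= i < n) sub (F i)) =
    (fun n => \sum_(0 <= i < n) nu (F i) - \sum_(0 <= i < n) mu (F i)).
  apply/funext => n; rewrite -fin_num_sumeN => [|i _]; last by rewrite fin_num_measure.
  by rewrite -big_split/=; apply: eq_bigr => i _; rewrite measure_subE.
apply: cvgeB; first by rewrite fin_num_adde_defl// fin_numN fin_num_measure.
- exact: measure_semi_sigma_additive.
- exact: measure_semi_sigma_additive.
Qed.

HB.instance Definition _ := isMeasure.Build _ _ _ sub
  sub0 sub_ge0 sub_sigma_additive.

Let sub_fin : fin_num_fun sub.
Proof. by move=> A mA; rewrite measure_subE// fin_numB !fin_num_measure. Qed.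

HB.instance Definition _ := Measure_isFinite.Build _ _ _ sub sub_fin.

End measure_difference.

(** * Integrals against product laws and means of bounded functions *)

Section iid_law_integral.
Local Open Scope ereal_scope.
Context {d : measure_display} {T : measurableType d} {R : realType}.

Lemma probability_integral_cst (mu : probability T R) (k : \bar R) :
  \int[mu]_x k = k.
Proof. by rewrite integral_cst// [X in _ * X]probability_setT mule1. Qed.

Lemma ge0_integral_iid_lawS (mu : probability T R) n (f : n.+1.-tuple T -> \bar R) :
  measurable_fun setT f -> (forall x, 0 <= f x) ->
  \int[iid_law mu n.+1]_x f x =
  \int[mu]_x \int[iid_law mu n]_y f (cons_tuple (x, y)).
Proof.
move=> mf f0; rewrite ge0_integral_distribution// fubini_tonelli1//.
  by apply: measurableT_comp => //; exact: measurable_cons_tuple.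
by move=> x; exact: f0.
Qed.

End iid_law_integral.

Section bounded_mean.
Context {d : measure_display} {T : measurableType d} {R : realType}.

Lemma bounded_integrable (mu : {finite_measure set T -> \bar R}) (f : T -> R) M :
  measurable_fun setT f -> (forall x, `|f x| <= M) ->
  mu.-integrable setT (EFin \o f).
Proof.
move=> mf fM; apply: measurable_bounded_integrable => //.
  by rewrite ltey_eq fin_num_measure.
exists M; split; first exact: num_real.
by move=> r Mr x _; exact: le_trans (fM x) (ltW Mr).
Qed.

Lemma mean_addl (mu : probability T R) (f : T -> R) K M :
  measurable_fun setT f -> (forall x, `|f x| <= M) ->
  mean mu (fun x => K + f x) = K + mean mu f.
Proof.
move=> mf fM; rewrite /mean RintegralD//.
- by rewrite /Rintegral probability_integral_cst.
- exact: (@bounded_integrable _ _ `|K|).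
- exact: bounded_integrable.
Qed.

Lemma meanB (mu : probability T R) (f g : T -> R) M :
  measurable_fun setT f -> (forall x, `|f x| <= M) ->
  measurable_fun setT g -> (forall x, `|g x| <= M) ->
  mean mu (fun x => f x - g x) = mean mu f - mean mu g.
Proof.
by move=> mf fM mg gM; rewrite /mean RintegralB//; exact: bounded_integrable.
Qed.

End bounded_mean.

(** * Coupling a sample of Q with a sample of [nu] *)

Section coupling.
Local Open Scope ereal_scope.
Context {dU d : measure_display} {TU : measurableType dU}
  {T : measurableType d} {R : realType}.
Variables (PU : probability TU R) (G : {mfun TU >-> T}) (nu : probability T R).
(** In the application [c] is 1/C and [rest] is nu - c Q, a measure of mass 1 - c. *)
Variables (c : {nonneg R}) (rest : {finite_measure set T -> \bar R}).
Local Notation Q := (generated PU G).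
Hypothesis nuE : forall A, measurable A -> nu A = c%:num%:E * Q A + rest A.

Lemma ge0_integral_mixture (f : T -> \bar R) :
  measurable_fun setT f -> (forall x, 0 <= f x) ->
  \int[nu]_x f x = c%:num%:E * \int[Q]_x f x + \int[rest]_x f x.
Proof.
move=> mf f0.
rewrite (eq_measure_integral (measure_add (mscale c Q) rest)); last first.
  by move=> A mA _; rewrite [RHS]measure_addE; exact: nuE.
by rewrite ge0_integral_measure_add// ge0_integral_mscale.
Qed.

(** The nonnegative case applies to the positive and negative parts; boundedness makes all the
    integrals finite, so that they can be subtracted. *)
Lemma mean_mixture (f : T -> R) M :
  measurable_fun setT f -> (forall x, `|f x| <= M)%R ->
  (\int[rest]_x f x = mean nu f - c%:num * mean Q f)%R.
Proof.
move=> mf fM.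
have fin (mu : {finite_measure set T -> \bar R}) :
    \int[mu]_x ((EFin \o f)^\+ x) \is a fin_num /\
    \int[mu]_x ((EFin \o f)^\- x) \is a fin_num.
  have If := bounded_integrable mu mf fM.
  by split; [exact: integrable_pos_fin_num|exact: integrable_neg_fin_num].
have mE : measurable_fun setT (EFin \o f) by exact/measurable_EFinP.
have Hp : \int[nu]_x ((EFin \o f)^\+ x) = _ :=
  ge0_integral_mixture (measurable_funepos mE) (fun=> funepos_ge0 _ _).
have Hn := ge0_integral_mixture (measurable_funeneg mE) (fun=> funeneg_ge0 _ _).
rewrite /mean /Rintegral !(integralE _ _ (EFin \o f)) Hp Hn.
have [/fineK <- /fineK <-] := fin Q.
have [/fineK <- /fineK <-] := fin rest.
rewrite /=; ring.
Qed.

(* One coordinate of a sample from [nu] is obtained from a draw [y] of [Q] by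
   the kernel [K y = c * dirac y + rest], for which [Q K = nu] and
   [K y (f - nu f) = c * (f y - Q f)].  Hence [H] is [Phi] averaged over the
   product of these kernels, and the last claim is Jensen's inequality. *)
Lemma domination_coupling n : forall dS (S : measurableType dS)
    (Phi : S * n.-tuple T -> \bar R),
  measurable_fun setT Phi -> (forall z, 0 <= Phi z) ->
  exists H : S * n.-tuple TU -> \bar R,
    [/\ measurable_fun setT H, forall z, 0 <= H z,
      forall s, \int[iid_law PU n]_u H (s, u) = \int[iid_law nu n]_x Phi (s, x) &
      forall s (f : T -> R) (a M : R),
        measurable_fun setT f -> (forall x, `|f x| <= M)%R ->
        (forall x, `|a + \sum_(i < n) (f (tnth x i) - mean nu f)|%:E <= Phi (s, x)) ->
        forall u, `|a + c%:num * \sum_(i < n) (f (G (tnth u i)) - mean Q f)|%:E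
          <= H (s, u)].
Proof.
(* The parameter space [S] is arbitrary because the induction moves the coordinates already drawn
   into it; the offset [a] carries their contribution to the sum. *)
elim: n => [|n IH] dS S Phi mPhi Phi0.
  exists (fun z => Phi (z.1, [tuple])); split => //.
  - by apply: measurableT_comp => //; exact: measurable_fun_pair.
  - move=> s; transitivity (Phi (s, [tuple])).
      exact: (probability_integral_cst (iid_law PU 0) (Phi (s, [tuple]))).
    rewrite -[LHS](probability_integral_cst (iid_law nu 0)).
    by apply: eq_integral => x _; rewrite (tuple0 x).
  - move=> s f a M mf fM H u; have := H [tuple].
    by rewrite !big_ord0 mulr0 (tuple0 u).
pose Phi1 (z : (S * T) * n.-tuple T) := Phi (z.1.1, cons_tuple (z.1.2, z.2)).
have mPhi1 : measurable_fun setT Phi1.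
  apply: measurableT_comp => //; apply: measurable_fun_pair => /=.
    by apply: measurableT_comp.
  apply: measurableT_comp; first exact: measurable_cons_tuple.
  by apply: measurable_fun_pair => //=; apply: measurableT_comp.
have [H1 [mH1 H10 intH1 domH1]] := IH _ _ Phi1 mPhi1 (fun=> Phi0 _).
pose Hr (z : S * n.-tuple TU) := \int[rest]_x H1 ((z.1, x), z.2).
have mHr : measurable_fun setT Hr.
  apply: (@measurable_fun_fubini_tonelli_F _ _ _ _ _ rest
    (fun z : (S * n.-tuple TU) * T => H1 ((z.1.1, z.2), z.1.2))) => //.
  apply: measurableT_comp => //; apply: measurable_fun_pair => /=.
    by apply: measurable_fun_pair => //=; apply: measurableT_comp.
  by apply: measurableT_comp.
have Hr0 z : 0 <= Hr z by apply: integral_ge0.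
pose tl (u : n.+1.-tuple TU) : n.-tuple TU := [tuple of behead u].
have mtl : measurable_fun setT tl by exact: measurable_behead.
(* [H] integrates [H1] against the kernel at y = G (thead u): the atom at y gives the first term,
   [rest] gives [Hr]. *)
pose H (z : S * n.+1.-tuple TU) : \bar R :=
  c%:num%:E * H1 ((z.1, G (thead z.2)), tl z.2) + Hr (z.1, tl z.2).
have mH1s s : measurable_fun setT (fun z : T * n.-tuple TU => H1 ((s, z.1), z.2)).
  apply: measurableT_comp => //; apply: measurable_fun_pair => //=.
  by apply: measurable_fun_pair => //=.
have mH : measurable_fun setT H.
  have mtl2 : measurable_fun setT (fun z : S * n.+1.-tuple TU => tl z.2).
    exact: measurableT_comp.
  apply: emeasurable_funD; last first.
    by apply: measurableT_comp => //; exact: measurable_fun_pair.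
  apply: measurable_funeM; apply: measurableT_comp => //.
  apply: measurable_fun_pair => //=; apply: measurable_fun_pair => //=.
  apply: measurableT_comp => //.
  exact: (measurableT_comp (measurable_tnth ord0)).
have H0 z : 0 <= H z by rewrite adde_ge0// mule_ge0.
exists H; split => //.
- move=> s; pose A y := \int[iid_law PU n]_u H1 ((s, y), u).
  have A0 y : 0 <= A y by apply: integral_ge0.
  have mA : measurable_fun setT A.
    exact: (@measurable_fun_fubini_tonelli_F _ _ _ _ _ (iid_law PU n)
      (fun z : T * n.-tuple TU => H1 ((s, z.1), z.2))).
  have mHs : measurable_fun setT (fun u => H (s, u)).
    by apply: measurableT_comp => //; exact: measurable_fun_pair.
  have mH1u x : measurable_fun setT (fun u => H1 ((s, x), u)).
    by apply: measurableT_comp => //; exact: measurable_fun_pair.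
  have mHru : measurable_fun setT (fun u => Hr (s, u)).
    by apply: measurableT_comp => //; exact: measurable_fun_pair.
  have mPhis : measurable_fun setT (fun u => Phi (s, u)).
    by apply: measurableT_comp => //; exact: measurable_fun_pair.
  rewrite ge0_integral_iid_lawS// [RHS]ge0_integral_iid_lawS//.
  (* Integrating out the tail leaves c A(G x) plus a term constant in x. Averaging over x gives c
     Q[A] + rest[A] = nu[A], the second term by Tonelli. *)
  transitivity (\int[PU]_x (c%:num%:E * A (G x) + \int[iid_law PU n]_u Hr (s, u))).
    apply: eq_integral => x _.
    rewrite -ge0_integralZl// -ge0_integralD//; last 2 first.
      by move=> u _; rewrite mule_ge0.
      exact: measurable_funeM.
    apply: eq_integral => u _; rewrite /H /= theadE.
    by congr (_ * H1 (_, _) + Hr (_, _)); apply: val_inj.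
  have mAG : measurable_fun setT (fun x => A (G x)) by exact: measurableT_comp.
  rewrite ge0_integralD//; last 3 first.
    by move=> x _; rewrite mule_ge0.
    exact: measurable_funeM.
    by move=> x _; exact: integral_ge0.
  rewrite probability_integral_cst ge0_integralZl//.
  rewrite [RHS](eq_integral A); last by move=> x _; rewrite /A intH1.
  rewrite ge0_integral_mixture// ge0_integral_distribution//; congr (_ + _).
  rewrite /Hr /A; apply: (fubini_tonelli (m1 := iid_law PU n) (m2 := rest)
    (fun z : n.-tuple TU * T => H1 ((s, z.2), z.1))) => //.
  apply: measurableT_comp => //; apply: measurable_fun_pair => //=.
  by apply: measurable_fun_pair => //=; exact: measurable_cst.
- move=> s f a M mf fM dom u.
  set y := G (thead u); set t := tl u.
  pose D := (\sum_(i < n) (f (G (tnth t i)) - mean Q f))%R.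
  (* [g x] is the quantity to bound when the first coordinate is the draw x and the others are
     already averaged over their kernels. The induction hypothesis bounds it, with offset a + (f x -
     nu f). *)
  pose K := (a - mean nu f + c%:num * D)%R; pose g x := (K + f x)%R.
  have gH1 x : `|g x|%:E <= H1 ((s, x), t).
    have -> : (g x = a + (f x - mean nu f) + c%:num * D)%R by rewrite /g /K; ring.
    apply: (domH1 (s, x) f _ M mf fM) => xs.
    have := dom (cons_tuple (x, xs)).
    rewrite big_ord_recl tnth0 addrA.
    by under eq_bigr do rewrite tnthS.
  have mg : measurable_fun setT g.
    by apply: measurable_funD => //; exact: measurable_cst.
  have gM x : (`|g x| <= `|K| + M)%R by rewrite (le_trans (ler_normD _ _))// lerD2l.
  rewrite big_ord_recl (_ : tnth u ord0 = thead u)//.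
  have -> : (\sum_(i < n) (f (G (tnth u (lift ord0 i))) - mean Q f) = D)%R.
    by apply: eq_bigr => i _; rewrite [in LHS](tuple_eta u) tnthS.
  rewrite -/y.
  (* The right-hand side is the kernel average of [g] at [y]; the constants recombine because [rest]
     has mass 1 - c. *)
  have -> : (a + c%:num * (f y - mean Q f + D) =
      c%:num * g y + \int[rest]_x g x)%R.
    by rewrite (mean_mixture mg gM) !(mean_addl _ _ mf fM) /g /K; ring.
  (* Jensen's inequality for the kernel; afterwards [gH1] is used under both the atom and [rest]. *)
  apply: (@le_trans _ _ (c%:num%:E * `|g y|%:E + \int[rest]_x `|g x|%:E)).
    rewrite -EFinM (le_trans (y := (`|c%:num * g y| + `|\int[rest]_x g x|)%:E))//.
      by rewrite lee_fin ler_normD.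
    rewrite EFinD normrM ger0_norm// leeD2l// EFin_normr_Rintegral//.
      by apply: le_abse_integral => //; exact/measurable_EFinP.
    exact: bounded_integrable gM.
  apply: leeD; first by rewrite lee_wpmul2l.
  apply: ge0_le_integral => //.
    by apply/measurable_EFinP; exact: measurableT_comp.
  by apply: (measurableT_comp mH1); apply: measurable_fun_pair.
Qed.

End coupling.

(** * Conditional bootstrap probability for a fixed generator and sample size *)

Section sup_abs_theory.
Context {R : realType} {S : Type} (A : set S) (h : S -> R).

Lemma sup_abs_ge0 : (0 <= sup_abs A h)%E.
Proof. by apply: ereal_sup_ubound; left. Qed.

Lemma le_sup_abs s : A s -> (`|h s|%:E <= sup_abs A h)%E.
Proof. by move=> As; apply: ereal_sup_ubound; right; exists s. Qed.

Lemma sup_abs_le M : (0 <= M)%E -> (forall s, A s -> `|h s|%:E <= M)%E ->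
  (sup_abs A h <= M)%E.
Proof. by move=> M0 hM; apply: ge_ereal_sup => _ [->//|[s /hM ? <-]]. Qed.

End sup_abs_theory.

Section bootstrap_bound.
Context {dU d : measure_display} {TU : measurableType dU}
  {T : measurableType d} {R : realType}.

(** Moves the factor 1/sqrt n inside the function, which gives the form of sum treated by
    [domination_coupling]. *)
Lemma emp_processE (mu : probability T R) n (x : n.-tuple T) (a : T -> R) M :
  measurable_fun setT a -> (forall x, `|a x| <= M) ->
  emp_process mu x a =
  \sum_(i < n) ((Num.sqrt n%:R)^-1 * a (tnth x i)
                - mean mu (fun y => (Num.sqrt n%:R)^-1 * a y)).
Proof.
move=> ma aM; rewrite /emp_process mulr_sumr; apply: eq_bigr => i _.
by rewrite /mean RintegralZl ?mulrBr//; exact: bounded_integrable aM.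
Qed.

Lemma boot_processB (mu : probability T R) n (z : n.-tuple T) (f g : T -> R) M :
  measurable_fun setT f -> (forall x, `|f x| <= M) ->
  measurable_fun setT g -> (forall x, `|g x| <= M) ->
  boot_process mu z f - boot_process mu z g =
  emp_process mu z (fun x => f x - g x).
Proof.
move=> mf fM mg gM; rewrite /emp_process (meanB _ mf fM mg gM).
rewrite big_split/= sumrB sumrN sumr_const card_ord /boot_process.
move: (\sum_(i < n) f _) (\sum_(i < n) g _) => sf sg.
(* For n = 0 both sides vanish, as the inverse of 0 is 0; otherwise sqrt n / n = 1 / sqrt n. *)
have [n0|n0] := eqVneq n 0%N; first by rewrite n0 sqrtr0 invr0 !mul0r subr0.
have s0 : Num.sqrt n%:R != 0 :> R by rewrite gt_eqF// sqrtr_gt0 ltr0n lt0n.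
rewrite -[(mean mu f - _) *+ n]mulr_natr; move: (sqr_sqrtr (ler0n R n)) s0.
by move: (Num.sqrt _) => s <- s0; field.
Qed.

Variables (PU : probability TU R) (G : {mfun TU >-> T}).
Variables (P nu : probability T R) (F : set (T -> R)) (M C : R).
Hypothesis mF : forall f, F f -> measurable_fun setT f.
Hypothesis FM : forall f, F f -> forall x, `|f x| <= M.
Hypothesis C0 : 0 < C.
Hypothesis dom : dominated_by (generated PU G) C nu.

(** Markov's inequality for C H, where H comes from the coupling: C H dominates the bootstrap
    modulus, and H has the same mean as the [nu]-modulus. *)
Lemma boot_prob_le n (delta eps : R) : 0 < eps ->
  measurable_fun [set: n.-tuple T]
    (fun x => sup_abs (diff_class P F delta) (emp_process nu x)) ->
  measurable_fun [set: n.-tuple TU] (boot_modulus PU G P F delta) ->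
  (eps%:E * boot_prob PU G P F n delta eps <=
   C%:E * \int[iid_law nu n]_x
            sup_abs (diff_class P F delta) (emp_process nu x))%E.
Proof.
move=> eps0 mS mB.
have c0 : 0 <= C^-1 by rewrite invr_ge0 ltW.
pose c : {nonneg R} := NngNum c0.
pose Q := generated PU G.
have cQ_le A : measurable A -> (mscale c Q A <= nu A)%E.
  move=> mA; rewrite /mscale/= -(@lee_pmul2l _ C%:E)// ?lte_fin//.
  by rewrite muleA -EFinM divff ?gt_eqF// mul1e dom.
have nuE A : measurable A -> nu A = (c%:num%:E * Q A + measure_sub cQ_le A)%E.
  move=> mA; rewrite measure_subE// addeC subeK//.
  by rewrite fin_num_measure.
(* No coordinate has been drawn yet, hence the one-point parameter space. *)
pose Phi (z : unit * n.-tuple T) :=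
  sup_abs (diff_class P F delta) (emp_process nu z.2).
have mPhi : measurable_fun setT Phi by apply: (measurableT_comp mS).
have [H [mH H0 intH domH]] :=
  domination_coupling nuE mPhi (fun=> sup_abs_ge0 _ _).
have mHt : measurable_fun setT (fun u => H (tt, u)).
  by apply: measurableT_comp => //; exact: measurable_fun_pair.
have modulus_le u : (boot_modulus PU G P F delta u <= C%:E * H (tt, u))%E.
  apply: sup_abs_le => [|[f g] [/= Ff Fg fg]].
    by rewrite mule_ge0// lee_fin ltW.
  rewrite (boot_processB _ _ (mF Ff) (FM Ff) (mF Fg) (FM Fg)).
  have mfg : measurable_fun setT (fun x => f x - g x).
    by apply: measurable_funB; exact: mF.
  have fgM x : `|f x - g x| <= M + M.
    by rewrite (le_trans (ler_normB _ _))// lerD// FM.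
  rewrite -lee_pdivrMl// -EFinM -{1}(gtr0_norm (x := C^-1)) ?invr_gt0//.
  rewrite -normrM (emp_processE _ _ mfg fgM).
  (* The same [H] serves every pair (f, g), since the coupling does not depend on the function. It
     is used for (f - g) / sqrt n with offset 0. *)
  pose h x := (Num.sqrt n%:R)^-1 * (f x - g x).
  have mh : measurable_fun setT h by exact: measurable_funM.
  have hM x : `|h x| <= `|(Num.sqrt n%:R)^-1| * (M + M).
    by rewrite normrM ler_wpM2l.
  under eq_bigr do rewrite tnth_map.
  rewrite -[_ * _]add0r; apply: (domH tt h 0 _ mh hM) => x.
  rewrite add0r -(emp_processE nu x mfg fgM); apply: le_sup_abs.
  by exists (f, g).
rewrite -(intH tt) -ge0_integralZl//; last by rewrite lee_fin ltW.
have mCH : measurable_fun setT (fun u => C%:E * H (tt, u))%E.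
  exact: measurable_funeM.
have CH0 u : (0 <= C%:E * H (tt, u))%E by rewrite mule_ge0// lee_fin ltW.
rewrite -[leRHS](_ : \int[iid_law PU n]_u `|C%:E * H (tt, u)| = _)%E; last first.
  by apply: eq_integral => u _; rewrite gee0_abs.
(* Markov's inequality; the strict event for the modulus lies in the event eps <= |C H|. *)
apply: le_trans (le_integral_abse _ measurableT mCH eps0).
apply: lee_wpmul2l; first by rewrite lee_fin ltW.
rewrite setTI; apply: (le_measure (iid_law PU n)); rewrite ?inE.
- rewrite -[X in measurable X]setTI; exact: emeasurable_fun_o_infty.
- rewrite -[X in measurable X]setTI; apply: emeasurable_fun_c_infty => //.
  exact: measurableT_comp.
- by move=> u /= /ltW eu; rewrite gee0_abs// (le_trans eu).
Qed.

End bootstrap_bound.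

(** * Countable algebras of sets *)

Section set_algebra.
Context {T : Type}.
Implicit Types (A B X : set T) (G : set (set T)).

Let step G : set (set T) :=
  G `|` [set ~` X | X in G] `|` [set XY.1 `|` XY.2 | XY in G `*` G].

Let countableU (S S' : set (set T)) :
  countable S -> countable S' -> countable (S `|` S').
Proof.
move=> cS cS'; rewrite -bigcup2E; apply: bigcup_countable => // -[|[|?]] _ //.
Qed.

(** Adding complements and binary unions stage by stage keeps every stage countable. Sets from
    stages m and n have their union in stage max(m, n) + 1. *)
Lemma countable_set_algebra G : countable G -> exists A : set (set T),
  [/\ countable A, G `<=` A, setC_closed A, setU_closed A &
      forall H : set (set T), sigma_algebra setT H -> G `<=` H -> A `<=` H].
Proof.
move=> cG; pose A n := iter n step G.
have cA n : countable (A n).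
  elim: n => //= n cAn; apply: countableU.
    by apply: countableU => //; exact: sub_countable (card_image_le _ _) _.
  by apply: sub_countable (card_image_le _ _) _; exact: countableX.
have mono m n : (m <= n)%N -> A m `<=` A n.
  move=> /subnK <-; elim: (n - m)%N => //= k IH X /IH ?; by left; left.
exists (\bigcup_n A n); split.
- exact: bigcup_countable.
- by move=> X GX; exists 0%N.
- by move=> X [n _ AX]; exists n.+1 => //; left; right; exists X.
- move=> X Y [m _ AX] [n _ AY]; exists (maxn m n).+1 => //; right.
  exists (X, Y) => //; split => /=.
    exact: mono (leq_maxl m n) _ AX.
  exact: mono (leq_maxr m n) _ AY.
- move=> H [H0 HC HU] GH X [n _]; elim: n X => /= [|n IH] X; first exact: GH.
  case=> [[/IH//|[Y /IH HY <-]]|[[Y Z] [/= /IH HY /IH HZ] <-]].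
    by rewrite -setTD; exact: HC.
  by rewrite -bigcup2E; apply: HU => -[|[|?]].
Qed.

End set_algebra.

(** * Approximation in measure by the sets of a generating algebra *)

Section approximation.
Local Open Scope ereal_scope.
Context {d : measure_display} {T : measurableType d} {R : realType}.
Variables (mu : {measure set T -> \bar R}) (A : set (set T)).
Hypothesis mu_fin : mu setT < +oo.
Hypotheses (AC : setC_closed A) (AU : setU_closed A) (A_neq0 : A !=set0).
Hypothesis mA : A `<=` measurable.

(** Good-sets principle: this family is shown to be a sigma-algebra containing [A]. *)
Let apx : set (set T) :=
  [set B | measurable B /\ forall e : R, (0 < e)%R ->
     exists2 X, A X & mu (B `+` X) < e%:E].

Let mY (X Y : set T) : measurable X -> measurable Y -> measurable (X `+` Y).
Proof. by move=> mX mY; apply: measurableU; exact: measurableD. Qed.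

Let A_apx : A `<=` apx.
Proof.
move=> X AX; split => [|e e0]; first exact: mA.
by exists X => //; rewrite setYK measure0 lte_fin.
Qed.

Let apxC : setC_closed apx.
Proof.
move=> B [mB hB]; split => [|e /hB[X AX Xe]]; first exact: measurableC.
exists (~` X); first exact: AC.
rewrite (_ : ~` B `+` ~` X = B `+` X)//.
by apply/seteqP; split => x /=; case: (pselect (B x)); case: (pselect (X x)); tauto.
Qed.

Let mu_cover_lt (e : R) (X Y Z : set T) : measurable X -> measurable Y -> measurable Z ->
  X `<=` Y `|` Z -> mu Y < (e / 2)%:E -> mu Z < (e / 2)%:E -> mu X < e%:E.
Proof.
move=> mX mY' mZ XYZ Ye Ze.
apply: (@le_lt_trans _ _ (mu (Y `|` Z))).
  by apply: le_measure; rewrite ?inE//; exact: measurableU.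
apply: (le_lt_trans (measureU2 mu mY' mZ)).
by rewrite [e]splitr EFinD lteD.
Qed.

Let apxU : setU_closed apx.
Proof.
move=> B1 B2 [mB1 h1] [mB2 h2]; split => [|e e0]; first exact: measurableU.
have [X1 AX1 X1e] := h1 (e / 2)%R ltac:(by rewrite divr_gt0).
have [X2 AX2 X2e] := h2 (e / 2)%R ltac:(by rewrite divr_gt0).
have mX1 := mA AX1; have mX2 := mA AX2.
exists (X1 `|` X2); first exact: AU.
apply: mu_cover_lt X1e X2e; do ?exact: mY.
  by apply: mY; exact: measurableU.
by move=> x /=; tauto.
Qed.

(** By continuity from above, where finiteness of [mu] enters, some F n misses less than e/2 of the
    union; a member of [A] within e/2 of that F n then works. *)
Let apx_nd : ndseq_closed apx.
Proof.
move=> F ndF hF; have mF n : measurable (F n) by case: (hF n).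
have mU : measurable (\bigcup_n F n) by exact: bigcupT_measurable.
split=> // e e0; have e20 : (0 < e / 2)%R by rewrite divr_gt0.
pose D n := (\bigcup_n F n) `\` F n.
have mD n : measurable (D n) by exact: measurableD.
have [n hn] : exists n, mu (D n) < (e / 2)%:E.
  have DI : \bigcap_n D n = set0.
    by apply/seteqP; split => // x DIx; have [[n _ Fn] _] := DIx 0%N I; case: (DIx n I).
  have : mu \o D @ \oo --> mu (\bigcap_n D n).
    apply: nonincreasing_cvg_mu => //.
    - apply: le_lt_trans mu_fin; apply: le_measure; rewrite ?inE//.
    - by rewrite DI.
    - move=> m n mn; apply/subsetPset; apply: setDS.
      by apply/subsetPset; exact: ndF.
  rewrite DI measure0 => /(_ _ (open_ereal_lt' (y := (e / 2)%:E) _)) -[].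
    by rewrite lte_fin.
  by move=> n _ hn; exists n; exact: (hn n (leqnn n)).
have [X AX Xe] := (hF n).2 _ e20; have mX := mA AX.
exists X => //; apply: mu_cover_lt hn Xe => //; do ?exact: mY.
have FU x : F n x -> (\bigcup_n F n) x by exists n.
move=> x; have := FU x; rewrite /D /setY /setD /setU /mkset.
by case: (pselect (F n x)); tauto.
Qed.

Lemma sigma_algebra_approx B (e : R) : <<s A>> B -> (0 < e)%R ->
  exists2 X, A X & mu (B `+` X) < e%:E.
Proof.
move=> sB e0; suff [_] : apx B by apply.
have apxI : setI_closed apx.
  by move=> X Y aX aY; rewrite -(setCK (X `&` Y)) setCI; do ?[apply: apxC|apply: apxU].
apply: sB; split; last exact: A_apx.
apply/sigma_algebraP => //; split => //.
  have [X /A_apx aX] := A_neq0; rewrite -(setUv X).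
  by apply: apxU => //; exact: apxC.
by move=> X Y _ aX aY; rewrite setDE; apply: apxI => //; exact: apxC.
Qed.

End approximation.

(** * Domination tested on an algebra, and measurability of its failure *)

Section domination_measurable.
Local Open Scope ereal_scope.
Context {d : measure_display} {T : measurableType d} {R : realType}.

(** Choose X in [A] close to B for mu + nu, within e1 = e / (1 + C). Then mu B <= mu X + e1 <= C nu
    X + e1 <= C nu B + (1 + C) e1, and the last error is e. *)
Lemma dominated_by_algebra (A : set (set T)) (mu nu : probability T R) (C : R) :
  setC_closed A -> setU_closed A -> A !=set0 -> A `<=` measurable ->
  measurable `<=` <<s A>> -> (0 <= C)%R ->
  (forall X, A X -> mu X <= C%:E * nu X) -> dominated_by mu C nu.
Proof.
move=> AC AU A0 mA sA C0 dom B mB; apply/lee_addgt0Pr => e e0.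
have fin : measure_add mu nu setT < +oo.
  by rewrite measure_addE lte_add_pinfty// -ge0_fin_numE// fin_num_measure.
have e1 : (0 < e / (1 + C))%R by rewrite divr_gt0// ltr_wpDr.
have [X AX Xe] := sigma_algebra_approx fin AC AU A0 mA (sA _ mB) e1.
have mX := mA _ AX.
have mY : measurable (B `+` X) by apply: measurableU; exact: measurableD.
have {}Xe : mu (B `+` X) + nu (B `+` X) < (e / (1 + C))%:E.
  by rewrite -measure_addE.
have mue : mu (B `+` X) <= (e / (1 + C))%:E.
  by apply: le_trans (ltW Xe); rewrite leeDl.
have nue : nu (B `+` X) <= (e / (1 + C))%:E.
  by apply: le_trans (ltW Xe); rewrite leeDr.
have cover (m : probability T R) U V : measurable U -> measurable V ->
    U `<=` V `|` (B `+` X) -> m U <= m V + m (B `+` X).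
  move=> mU mV UV; apply: le_trans (measureU2 m mV mY).
  by apply: le_measure; rewrite ?inE//; exact: measurableU.
have muB : mu B <= mu X + mu (B `+` X).
  by apply: cover => // x; rewrite /setY /setD /setU /mkset; case: (pselect (X x)); tauto.
have nuX : nu X <= nu B + nu (B `+` X).
  by apply: cover => // x; rewrite /setY /setD /setU /mkset; case: (pselect (B x)); tauto.
have -> : e%:E = C%:E * (e / (1 + C))%:E + (e / (1 + C))%:E.
  by rewrite -EFinM -EFinD; congr EFin; field; rewrite gt_eqF// ltr_wpDr.
rewrite addeA -ge0_muleDr// ?lee_fin ?(ltW e1)//.
apply: (le_trans muB); apply: leeD => //; apply: (le_trans (dom _ AX)).
apply: lee_wpmul2l; first by rewrite lee_fin.
by apply: (le_trans nuX); exact: leeD.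
Qed.

End domination_measurable.

Section dominated_event.
Context {R : realType}.

(** Half-spaces with rational thresholds suffice: the ray above x is the union of the rays above the
    rationals q > x. *)
Lemma tuple_countably_generated (p : nat) : exists G : set (set (p.-tuple R)),
  [/\ countable G, G `<=` measurable & measurable `<=` <<s G>>].
Proof.
pose half (iq : 'I_p * rat) : set (p.-tuple R) :=
  (fun x => tnth x iq.1) @^-1` `]ratr iq.2, +oo[.
exists (range half); split.
- exact: sub_countable (card_image_le _ _) _.
- move=> _ [iq _ <-]; rewrite /half -[X in measurable X]setTI.
  exact: measurable_tnth.
(* It suffices that the identity is measurable from the generated sigma-algebra, and this is checked
   coordinate by coordinate. *)
- have mid : measurable_fun [set: g_sigma_algebraType (range half)]
      (fun x : g_sigma_algebraType (range half) => x : p.-tuple R).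
    apply/measurable_fun_tnthP => i.
    apply: (measurability _ (RGenOInfty.measurableE R)).
    move=> _ [_ [x ->] <-]; rewrite setTI.
    rewrite (_ : _ @^-1` _ = \bigcup_(q : rat)
        if x < ratr q then half (i, q) else set0).
      apply: bigcupT_measurable_rat => q; case: ifP => // _.
      by apply: sub_sigma_algebra; exists (i, q).
    apply/seteqP; split => [y /=|y [q _]].
      rewrite in_itv/= andbT => /rat_in_itvoo[q]; rewrite in_itv/= => /andP[xq qy].
      by exists q => //; rewrite xq /half /= in_itv/= qy.
    case: ifP => // xq; rewrite /half /= !in_itv/= !andbT; exact: lt_trans.
  by move=> A mA; have := mid measurableT _ mA; rewrite setTI.
Qed.

(* By [dominated_by_algebra] it suffices to test domination on a countable
   algebra generating the sigma-algebra of [T]. *)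
Lemma measurable_not_dominated_by (dO d : measure_display)
    (Omega : measurableType dO) (T : measurableType d)
    (k : Omega -> probability T R) (nu : probability T R) (C : R)
    (G : set (set T)) :
  countable G -> G `<=` measurable -> measurable `<=` <<s G>> -> 0 <= C ->
  (forall A, measurable A -> measurable_fun setT (fun w => k w A)) ->
  measurable [set w | ~ dominated_by (k w) C nu].
Proof.
move=> cG mG sG C0 mk.
(* The empty set is adjoined so that the algebra is nonempty even when [G] is empty. *)
have cG' : countable (G `|` [set set0]).
  by rewrite -bigcup2E; apply: bigcup_countable => // -[|[|?]] _ //; exact: countable1.
have [A [cA GA AC AU minA]] := countable_set_algebra cG'.
have mA : A `<=` measurable.
  apply: minA; first exact: sigma_algebra_measurable.
  by move=> X [/mG//|->].
have sA : measurable `<=` <<s A>>.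
  apply: (subset_trans sG); apply: sub_sigma_algebra2 => X GX; apply: GA; by left.
have A0 : A !=set0 by exists set0; apply: GA; right.
rewrite (_ : [set _ | _] = \bigcup_(X : A) [set w | (C%:E * nu (val X) < k w (val X))%E]).
  apply: countable_bigcupT_measurable.
    by rewrite (eq_countable (card_setT _)).
  move=> X; rewrite -[X in measurable X]setTI; apply: emeasurable_fun_o_infty => //.
  by apply: mk; exact: mA _ (set_valP X).
apply/seteqP; split => [w /= ndom|w [X _] /=].
  apply: contrapT => h; apply: ndom; apply: (dominated_by_algebra AC AU A0 mA sA C0).
  move=> X AX; rewrite leNgt; apply/negP => lt; apply: h.
  by exists (SigSub (mem_set AX)).
by move=> lt /(_ _ (mA _ (set_valP X))); rewrite leNgt lt.
Qed.

End dominated_event.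

(** * Upper limits and convergence to 0 of nonnegative functions *)

Section esup_limits.
Local Open Scope ereal_scope.
Context {R : realType}.

Lemma cvge0_lt {I : Type} (Fi : set_system I) (f : I -> \bar R) (e : R) :
  f x @[x --> Fi] --> 0 -> (0 < e)%R -> \forall x \near Fi, f x < e%:E.
Proof.
move=> cf e0; have e0' : 0 < e%:E by rewrite lte_fin.
exact: (cf _ (open_ereal_lt' e0')).
Qed.

Lemma ge0_cvge0 {I : Type} (Fi : set_system I) {FF : Filter Fi} (f : I -> \bar R) :
  (forall x, 0 <= f x) ->
  (forall e : R, (0 < e)%R -> \forall x \near Fi, f x < e%:E) ->
  f x @[x --> Fi] --> 0.
Proof.
move=> f0 fe A [e /= e0 eA].
rewrite /nbhs/=; apply: filterS (fe _ e0) => x fx /=.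
have : f x \is a fin_num by rewrite ge0_fin_numE// (lt_trans fx)// ltry.
move: (f0 x) fx; case: (f x) => // r; rewrite lee_fin lte_fin => r0 re _.
by apply: eA; rewrite /= sub0r normrN ger0_norm.
Qed.

(** The upper limit is an infimum, over the sets of the filter, of suprema; a value below x is
    witnessed by one such set. *)
Lemma limn_esup_lt (u : nat -> \bar R) (x : \bar R) :
  limn_esup u < x -> \forall n \near \oo, u n < x.
Proof.
move=> /ereal_inf_lt[_ [V VF <-] supV]; apply: filterS VF => n Vn.
by apply: le_lt_trans supV; apply: ereal_sup_ubound; exists n.
Qed.

Lemma le_limn_esup (u v : nat -> \bar R) :
  (\forall n \near \oo, u n <= v n) -> limn_esup u <= limn_esup v.
Proof.
move=> uv; apply: le_ereal_inf_tmp => _ [V VF <-].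
apply: (@le_trans _ _ (ereal_sup (u @` (V `&` [set n | u n <= v n])))).
  apply: ereal_inf_lbound.
  by exists (V `&` [set n | u n <= v n]) => //; exact: filterI.
apply: ge_ereal_sup => _ [n [Vn un] <-]; apply: le_trans un _.
by apply: ereal_sup_ubound; exists n.
Qed.

End esup_limits.

(** * Passage to the limit: first C, then delta *)

Theorem theorem2p3 (R : realType) (p : nat)
  (dO dU : measure_display)
  (Omega : measurableType dO) (Pr : probability Omega R)
  (TU : measurableType dU) (PU : probability TU R)
  (P : probability (p.-tuple R) R)
  (* the data: Z_0, Z_1, ... are i.i.d. from P *)
  (Z : nat -> {RV Pr >-> p.-tuple R})
  (HZ : forall (n : nat) (A : set (n.-tuple (p.-tuple R))), measurable A ->
      Pr [set w | A [tuple Z i w | i < n]] = iid_law P n A)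
  (* O n: the sigma-field of the information used to construct the generator;
     P_O is the restriction of Pr to O n *)
  (O : nat -> set (set Omega))
  (HOsigma : forall n, sigma_algebra setT (O n))
  (HOsub : forall n, O n `<=` measurable)
  (HOdata : forall n i, (i < n)%N ->
      forall A : set (p.-tuple R), measurable A -> O n (Z i @^-1` A))
  (* the fitted generator, jointly measurable in (information, base point) *)
  (G : nat -> Omega -> {mfun TU >-> p.-tuple R})
  (HG : forall n, measurable_fun [set: g_sigma_algebraType (O n) * TU]
      (fun x => G n x.1 x.2))
  (* the function class *)
  (F : set (p.-tuple R -> R))
  (HFmeas : forall f, F f -> measurable_fun setT f)
  (HFenv : bounded_envelope F)
  (nu : probability (p.-tuple R) R)
  (* measurability of the suprema and of the conditional probabilities *)
  (Hsup : forall (m : nat) (delta : R), 0 < delta ->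
      measurable_fun [set: m.-tuple (p.-tuple R)]
        (fun x => sup_abs (diff_class P F delta) (emp_process nu x)))
  (Hboot : forall (n : nat) (w : Omega) (delta : R), 0 < delta ->
      measurable_fun [set: n.-tuple TU] (boot_modulus PU (G n w) P F delta))
  (Hcond : forall (n : nat) (delta eps : R), 0 < delta -> 0 < eps ->
      measurable_fun [set: g_sigma_algebraType (O n)]
        (fun w => boot_prob PU (G n w) P F n delta eps))
  (* asymptotic domination of Q_n by nu *)
  (Hdom : limn_esup (fun n =>
        Pr [set w | ~ dominated_by (generated PU (G n w)) C nu])
      @[C --> +oo] --> 0%E)
  (* asymptotic equicontinuity under nu *)
  (Hequi : limn_esup (fun m =>
        (\int[iid_law nu m]_x
           sup_abs (diff_class P F delta) (emp_process nu x))%E)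
      @[delta --> 0^'+] --> 0%E) :
  forall eps eta : R, 0 < eps -> 0 < eta ->
    limn_esup (fun n =>
        Pr [set w | (eta%:E < boot_prob PU (G n w) P F n delta eps)%E])
      @[delta --> 0^'+] --> 0%E.
Proof.
move=> eps eta eps0 eta0.
have [E [[M EM] FE]] := HFenv.
have FM f : F f -> forall x, `|f x| <= M by move=> Ff x; exact: le_trans (FE f Ff x) (EM x).
have OM n (A : set Omega) : <<s O n>> A -> measurable A.
  by rewrite (sigma_algebra_id (HOsigma n)); exact: HOsub.
have [D [cD mD sD]] := tuple_countably_generated p (R := R).
have mdom n C : 0 <= C ->
    measurable [set w | ~ dominated_by (generated PU (G n w)) C nu].
  move=> C0; apply: (OM n).
  apply: (@measurable_not_dominated_by _ _ _ (g_sigma_algebraType (O n)) _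
    (fun w => generated PU (G n w)) nu C D) => // A mA.
  (* The [generated] mass of A at w is the [PU]-mass of the section at w of this preimage, hence
     measurable in w for the information. *)
  have mX : measurable ((fun x : g_sigma_algebraType (O n) * TU => G n x.1 x.2) @^-1` A).
    by rewrite -[X in measurable X]setTI; exact: HG.
  have := measurable_fun_xsection PU mX.
  congr measurable_fun; apply/funext => w /=; congr (PU _).
  by rewrite xsectionE.
have mboot n delta : 0 < delta ->
    measurable [set w | (eta%:E < boot_prob PU (G n w) P F n delta eps)%E].
  move=> delta0; apply: (OM n).
  have := emeasurable_fun_o_infty measurableT (Hcond n delta eps delta0 eps0) eta%:E.
  by rewrite setTI.
apply: ge0_cvge0 => [delta|tau tau0].
  exact: limf_esup_ge0.
(* C is fixed before delta, depending only on tau. *)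
have [C [C0 domC]] : exists C : R, 0 < C /\
    (limn_esup (fun n => Pr [set w | ~ dominated_by (generated PU (G n w)) C nu])
     < tau%:E)%E.
  have near_dom := cvge0_lt Hdom tau0.
  have near_pos : \forall C \near +oo, 0 < C :> R by exact: nbhs_pinfty_gt.
  by have [C []] := filter_ex (filterI near_pos near_dom); exists C.
(* Below this threshold, C times the [nu]-modulus is less than eps * eta. *)
have r0 : 0 < eta * eps / C by rewrite divr_gt0// mulr_gt0.
have delta_gt0 : \forall delta \near 0^'+, 0 < delta :> R by exact: nbhs_right_gt.
apply: filterS2 delta_gt0 (cvge0_lt Hequi r0) => delta delta0 /limn_esup_lt small.
apply: le_lt_trans domC; apply: le_limn_esup.
apply: filterS small => n small.
apply: le_measure; rewrite ?inE.
- exact: mboot.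
- by apply: mdom; exact: ltW.
(* Under domination, [boot_prob_le] with the same sample size n gives eps * boot_prob <= C *
   ([nu]-modulus) < eps * eta, against [eta_lt]. So the bad event lies in the failure of
   domination. *)
move=> w /= eta_lt dom.
have := boot_prob_le HFmeas FM C0 dom eps0 (Hsup n delta delta0)
  (Hboot n w delta delta0).
apply/negP; rewrite -ltNge.
apply: (@lt_trans _ _ (eps%:E * eta%:E)%E); last by rewrite lte_pmul2l// lte_fin.
rewrite -lte_pdivlMl// -EFinM (lt_le_trans small)// lee_fin.
by rewrite [leRHS]mulrC [eps * eta]mulrC.
Qed.
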